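(* Let $(A,\ast,\curlyvee,\diamond,\bullet)$ be an NS-$F$-manifold algebra. For $x,y\in A$ put $x\odot y=x\ast y+y\ast x+x\curlyvee y$ and $\{\!\!\{x,y\}\!\!\}=x\diamond y-y\diamond x+x\bullet y$. (i) Then $(A,\odot,\{\!\!\{~,~\}\!\!\})$ is an $F$-manifold algebra (called the sub-adjacent $F$-manifold algebra $A^c$). (ii) Moreover, the triple $(A,\mu,\rho)$ is a representation of the $F$-manifold algebra $A^c=(A,\odot,\{\!\!\{~,~\}\!\!\})$, where $\mu,\rho:A\to\mathrm{End}(A)$ are defined by $\mu_x(y)=x\ast y$ and $\rho_x(y)=x\diamond y$ for $x,y\in A$.
   Context: All vector spaces and (multi)linear maps are over a field $\mathbf{k}$ of characteristic $0$. Associative algebras are not required to be unital. An NS-commutative algebra is a triple $(A,\ast,\curlyvee)$ of a vector space $A$ with bilinear operations $\ast,\curlyvee$, where $\curlyvee$ is commutative, such that for all $x,y,z\in A$, with $x\odot y=x\ast y+y\ast x+x\curlyvee y$: $$x\ast(y\ast z)=(x\odot y)\ast z,\qquad x\ast(y\curlyvee z)+x\curlyvee(y\odot z)=y\ast(x\curlyvee z)+y\curlyvee(x\odot z).$$ An NS-Lie algebra is a triple $(A,\diamond,\bullet)$ of a vector space $A$ with bilinear operations $\diamond,\bullet$, where $\bullet$ is skew-symmetric, such that for all $x,y,z\in A$, with $\{\!\!\{x,y\}\!\!\}=x\diamond y-y\diamond x+x\bullet y$: $$x\diamond(y\diamond z)-(x\diamond y)\diamond z-y\diamond(x\diamond z)+(y\diamond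 x)\diamond z=(x\bullet y)\diamond z,$$ $$x\bullet\{\!\!\{y,z\}\!\!\}+y\bullet\{\!\!\{z,x\}\!\!\}+z\bullet\{\!\!\{x,y\}\!\!\}+x\diamond(y\bullet z)+y\diamond(z\bullet x)+z\diamond(x\bullet y)=0.$$ An NS-$F$-manifold algebra is a quintuple $(A,\ast,\curlyvee,\diamond,\bullet)$ such that $(A,\ast,\curlyvee)$ is an NS-commutative algebra, $(A,\diamond,\bullet)$ is an NS-Lie algebra, and for all $x,y,z,w\in A$: $$F_1(x\odot y,z,w)=x\ast F_1(y,z,w)+y\ast F_1(x,z,w),$$ $$\big(F_1(x,y,z)+F_1(x,z,y)+F_2(y,z,x)+F_3(x,y,z)\big)\ast w=F_2(y,z,x\ast w)-x\ast F_2(y,z,w),$$ $$F_3(x\odot y,z,w)+F_2(z,w,y\curlyvee x)=x\ast F_3(y,z,w)+y\ast F_3(x,z,w)+x\curlyvee\big(F_1(y,z,w)+F_1(y,w,z)+F_2(z,w,y)+F_3(y,z,w)\big)+y\curlyvee\big(F_1(x,z,w)+F_1(x,w,z)+F_2(z,w,x)+F_3(x,z,w)\big),$$ where $F_1,F_2,F_3:A^{\otimes3}\to A$ are $$F_1(x,y,z)=x\diamond(y\ast z)-y\ast(x\diamond z)-\{\!\!\{x,y\}\!\!\}\ast z,$$ $$F_2(x,y,z)=x\ast(y\diamond z)+y\ast(x\diamond z)-(x\odot y)\diamond z,$$ $$F_3(x,y,z)=x\bullet(y\odot z)+x\diamond(y\curlyvee z)-z\ast(x\bullet y)-y\ast(x\bullet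 z)-y\curlyvee\{\!\!\{x,z\}\!\!\}-\{\!\!\{x,y\}\!\!\}\curlyvee z.$$ An $F$-manifold algebra is a triple $(A,\cdot,\{~,~\})$ with $(A,\cdot)$ a commutative associative algebra, $(A,\{~,~\})$ a Lie algebra, and $P_{x\cdot y}(z,w)=x\cdot P_y(z,w)+y\cdot P_x(z,w)$ for all $x,y,z,w\in A$, where $P_x(y,z)=\{x,y\cdot z\}-\{x,y\}\cdot z-y\cdot\{x,z\}$. A representation of an $F$-manifold algebra $(A,\cdot,\{~,~\})$ is a triple $(V,\mu,\rho)$ where $(V,\mu)$ is a representation of the commutative associative algebra $(A,\cdot)$ (i.e. $\mu:A\to\mathrm{End}(V)$ is linear with $\mu_{x\cdot y}=\mu_x\circ\mu_y$), $(V,\rho)$ is a representation of the Lie algebra $(A,\{~,~\})$, and for all $x,y,z\in A$: $$R_{\mu,\rho}(x\cdot y,z)=\mu_x\circ R_{\mu,\rho}(y,z)+\mu_y\circ R_{\mu,\rho}(x,z),\qquad \mu_{P_x(y,z)}=S_{\mu,\rho}(y,z)\circ\mu_x-\mu_x\circ S_{\mu,\rho}(y,z),$$ where $R_{\mu,\rho}(x,y)=\rho_x\circ\mu_y-\mu_y\circ\rho_x-\mu_{\{x,y\}}$ and $S_{\mu,\rho}(x,y)=\mu_x\circ\rho_y+\mu_y\circ\rho_x-\rho_{x\cdot y}$. *)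

(* Defs.v *)
From mathcomp Require Import all_boot all_algebra.

Set Implicit Arguments.
Unset Strict Implicit.
Unset Printing Implicit Defensive.

Import GRing.Theory.
Local Open Scope ring_scope.

(* Algebraic structures are predicates on plain functions that require         *)
(* bilinearity explicitly. A linear map A -> End(V) is given in uncurried      *)
(* form, i.e. as a bilinear map A -> V -> V.                                   *)
Definition bilinear_map (k : fieldType) (U V W : lmodType k)
    (f : U -> V -> W) : Prop :=
  (forall v, linear (f ^~ v)) /\ (forall u, linear (f u)).

Section FManifold.
Variables (k : fieldType) (A : lmodType k).

Record comm_assoc_algebra (m : A -> A -> A) : Prop := CommAssocAlgebra {
  caa_bilinear : bilinear_map m;
  caa_comm : commutative m;
  caa_assoc : associative m
}.

Record lie_algebra (br : A -> A -> A) : Prop := LieAlgebra {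
  lie_bilinear : bilinear_map br;
  lie_alternating : forall x, br x x = 0;
  lie_jacobi : forall x y z,
    br x (br y z) + br y (br z x) + br z (br x y) = 0
}.

Section Products.
Variables (m br : A -> A -> A).
Local Infix "⋅" := m (at level 40, left associativity).
Local Notation "⟦ x , y ⟧" := (br x y) (x at level 99, y at level 99).

Definition leibnizator (x y z : A) : A :=
  ⟦x, y ⋅ z⟧ - ⟦x, y⟧ ⋅ z - y ⋅ ⟦x, z⟧.
Local Notation P := leibnizator.

Record F_manifold_algebra : Prop := FManifoldAlgebra {
  fma_comm_assoc : comm_assoc_algebra m;
  fma_lie : lie_algebra br;
  fma_hertling_manin : forall x y z w,
    P (x ⋅ y) z w = x ⋅ P y z w + y ⋅ P x z w
}.

Variables (V : lmodType k) (mu rho : A -> V -> V).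

Record comm_assoc_representation : Prop := CommAssocRepresentation {
  car_bilinear : bilinear_map mu;
  car_mul : forall x y, mu (x ⋅ y) =1 mu x \o mu y
}.

Record lie_representation : Prop := LieRepresentation {
  lier_bilinear : bilinear_map rho;
  lier_bracket : forall x y,
    rho ⟦x, y⟧ =1 (rho x \o rho y) \- (rho y \o rho x)
}.

Definition rep_R (x y : A) : V -> V :=
  (rho x \o mu y) \- (mu y \o rho x) \- mu ⟦x, y⟧.

Definition rep_S (x y : A) : V -> V :=
  (mu x \o rho y) \+ (mu y \o rho x) \- rho (x ⋅ y).

Record F_manifold_representation : Prop := FManifoldRepresentation {
  fmr_base : F_manifold_algebra;
  fmr_comm_assoc : comm_assoc_representation;
  fmr_lie : lie_representation;
  fmr_R : forall x y z,
    rep_R (x ⋅ y) z =1 (mu x \o rep_R y z) \+ (mu y \o rep_R x z);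
  fmr_S : forall x y z,
    mu (P x y z) =1 (rep_S y z \o mu x) \- (mu x \o rep_S y z)
}.

End Products.

Section NS.
Variables (ast vee dia bul : A -> A -> A).
Local Infix "∗" := ast (at level 40, left associativity).
Local Infix "⋎" := vee (at level 40, left associativity).
Local Infix "⋄" := dia (at level 40, left associativity).
Local Infix "∙" := bul (at level 40, left associativity).

Definition ns_mul (x y : A) : A := x ∗ y + y ∗ x + x ⋎ y.
Definition ns_bracket (x y : A) : A := x ⋄ y - y ⋄ x + x ∙ y.
Local Infix "⊙" := ns_mul (at level 40, left associativity).
Local Notation "⟦ x , y ⟧" := (ns_bracket x y) (x at level 99, y at level 99).

Record NS_commutative_algebra : Prop := NSCommutativeAlgebra {
  nsc_ast_bilinear : bilinear_map ast;
  nsc_vee_bilinear : bilinear_map vee;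
  nsc_vee_comm : commutative vee;
  nsc_ast : forall x y z, x ∗ (y ∗ z) = (x ⊙ y) ∗ z;
  nsc_vee : forall x y z,
    x ∗ (y ⋎ z) + x ⋎ (y ⊙ z) = y ∗ (x ⋎ z) + y ⋎ (x ⊙ z)
}.

Record NS_Lie_algebra : Prop := NSLieAlgebra {
  nsl_dia_bilinear : bilinear_map dia;
  nsl_bul_bilinear : bilinear_map bul;
  nsl_bul_skew : forall x y, x ∙ y = - (y ∙ x);
  nsl_dia : forall x y z,
    x ⋄ (y ⋄ z) - (x ⋄ y) ⋄ z - y ⋄ (x ⋄ z) + (y ⋄ x) ⋄ z = (x ∙ y) ⋄ z;
  nsl_bul : forall x y z,
    x ∙ ⟦y, z⟧ + y ∙ ⟦z, x⟧ + z ∙ ⟦x, y⟧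
      + x ⋄ (y ∙ z) + y ⋄ (z ∙ x) + z ⋄ (x ∙ y) = 0
}.

Definition ns_F1 (x y z : A) : A :=
  x ⋄ (y ∗ z) - y ∗ (x ⋄ z) - ⟦x, y⟧ ∗ z.

Definition ns_F2 (x y z : A) : A :=
  x ∗ (y ⋄ z) + y ∗ (x ⋄ z) - (x ⊙ y) ⋄ z.

Definition ns_F3 (x y z : A) : A :=
  x ∙ (y ⊙ z) + x ⋄ (y ⋎ z) - z ∗ (x ∙ y) - y ∗ (x ∙ z)
    - y ⋎ ⟦x, z⟧ - ⟦x, y⟧ ⋎ z.

Local Notation F1 := ns_F1.
Local Notation F2 := ns_F2.
Local Notation F3 := ns_F3.

Record NS_F_manifold_algebra : Prop := NSFManifoldAlgebra {
  nsf_commutative : NS_commutative_algebra;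
  nsf_lie : NS_Lie_algebra;
  nsf_F1 : forall x y z w,
    F1 (x ⊙ y) z w = x ∗ F1 y z w + y ∗ F1 x z w;
  nsf_F2 : forall x y z w,
    (F1 x y z + F1 x z y + F2 y z x + F3 x y z) ∗ w
      = F2 y z (x ∗ w) - x ∗ F2 y z w;
  nsf_F3 : forall x y z w,
    F3 (x ⊙ y) z w + F2 z w (y ⋎ x)
      = x ∗ F3 y z w + y ∗ F3 x z w
        + x ⋎ (F1 y z w + F1 y w z + F2 z w y + F3 y z w)
        + y ⋎ (F1 x z w + F1 x w z + F2 z w x + F3 x z w)
}.

End NS.

End FManifold.

(* Main.v *)
Require Import Defs.
From mathcomp Require Import all_boot all_algebra.

Local Open Scope ring_scope.
Import GRing.Theory.

Set Implicit Arguments.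
Unset Strict Implicit.
Unset Printing Implicit Defensive.

(** The proof rests on one expansion ([leibnizatorE]): the Leibnizator P of the
    products ⊙ and ⟦ , ⟧ splits as

      P_x(y, z) = F1(x, y, z) + F1(x, z, y) + F2(y, z, x) + F3(x, y, z),

    while the operators R and S attached to left multiplications are, by
    definition, F1 and F2. Hence the first compatibility axiom of an
    NS-F-manifold algebra is the condition on R, and the second one, whose
    left-hand side becomes P_x(y, z) ∗ w, is the condition on S.

    The Hertling-Manin relation ([ns_hertling_manin]) follows by expanding
    P_(x ⊙ y)(z, w). The two F1 summands are given by the first axiom. The
    summand F2(z, w, x ⊙ y) is additive in x ⊙ y = x ∗ y + y ∗ x + x ⋎ y: on the
    first two pieces the second axiom produces P_x(z, w) ∗ y and P_y(z, w) ∗ x,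
    and the third piece is the correction that the third axiom adds to
    F3(x ⊙ y, z, w), where it produces x ⋎ P_y(z, w) and y ⋎ P_x(z, w).

    For the underlying commutative and Lie structures, the first NS-commutative
    axiom says that ∗ is an action of ⊙, and the first NS-Lie axiom that ⋄ is an
    action of the bracket. Associativity of the commutative product ⊙ amounts to
    the symmetry of x ⊙ (y ⊙ z) in x and y, which holds separately for the terms
    in ∗ alone, because ∗ is an action, and for the terms involving ⋎, by the
    second NS-commutative axiom. In the Jacobi sum, likewise, the terms in ⋄
    alone cancel because ⋄ is an action, and those involving ∙ vanish by the
    second NS-Lie axiom. *)

(** * Identities in abelian groups *)

(** Decides identities between signed sums of atoms in an abelian group: the
    difference of the sides is right-nested with a final 0, and the opposite of
    the head is then transposed towards the front until the two annihilate. It is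
    not transposed past an equal term, which would loop, nor past a copy of the
    head: the cancellation lemmas also rewrite inside the sum, so that they
    remove such an adjacent pair where it stands. *)
Ltac zmod :=
  apply/eqP; rewrite -subr_eq0; apply/eqP;
  rewrite ?(opprD, opprK, oppr0, addr0, add0r) -[LHS]addr0 -!addrA;
  repeat match goal with
  | |- - ?a + _ = 0 =>
    repeat match goal with |- context [?x + (a + ?z)] =>
      lazymatch x with - a => fail | a => fail | _ => rewrite (addrCA x a z) end
    end;
    rewrite (addKr a)
  | |- ?a + _ = 0 =>
    repeat match goal with |- context [?x + (?b + ?z)] =>
      lazymatch b with - a =>
        lazymatch x with a => fail | - a => fail | _ => rewrite (addrCA x b z) end
      end
    end;
    rewrite (addNKr a)
  end; reflexivity.

(** * Bilinear maps *)

Section BilinearMap.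
Variables (k : fieldType) (U V W : lmodType k).
Implicit Types f g : U -> V -> W.

Lemma bilinear_mapDl f : bilinear_map f ->
  forall u u' v, f (u + u') v = f u v + f u' v.
Proof.
by case=> lin _ u u' v; have := lin v 1 u u'; rewrite !scale1r.
Qed.

Lemma bilinear_mapDr f : bilinear_map f ->
  forall u v v', f u (v + v') = f u v + f u v'.
Proof.
by case=> _ lin u v v'; have := lin u 1 v v'; rewrite !scale1r.
Qed.

Lemma bilinear_mapNl f : bilinear_map f -> forall u v, f (- u) v = - f u v.
Proof.
case=> lin _ u v; have f0 : f 0 v = 0.
  by have := lin v (-1) 0 0; rewrite !scaleN1r oppr0 addr0 addNr.
by have := lin v (-1) u 0; rewrite !scaleN1r f0 !addr0.
Qed.

Lemma bilinear_mapNr f : bilinear_map f -> forall u v, f u (- v) = - f u v.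
Proof.
case=> _ lin u v; have f0 : f u 0 = 0.
  by have := lin u (-1) 0 0; rewrite !scaleN1r oppr0 addr0 addNr.
by have := lin u (-1) v 0; rewrite !scaleN1r f0 !addr0.
Qed.

Lemma bilinear_map_add f g : bilinear_map f -> bilinear_map g ->
  bilinear_map (fun u v => f u v + g u v).
Proof.
move=> [fl fr] [gl gr]; split=> [v|u] a x y /=.
  by rewrite fl gl scalerDr addrACA.
by rewrite fr gr scalerDr addrACA.
Qed.

Lemma bilinear_map_opp f : bilinear_map f ->
  bilinear_map (fun u v => - f u v).
Proof.
move=> [fl fr]; split=> [v|u] a x y /=.
  by rewrite fl opprD scalerN.
by rewrite fr opprD scalerN.
Qed.

End BilinearMap.

Lemma bilinear_map_flip (k : fieldType) (U V W : lmodType k) (f : U -> V -> W) :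
  bilinear_map f -> bilinear_map (fun v u => f u v).
Proof. by case=> fl fr; split. Qed.

(** * The commutative product of an NS-commutative algebra *)

Section NSCommutative.
Variables (k : fieldType) (A : lmodType k) (ast vee : A -> A -> A).
Hypothesis nscA : NS_commutative_algebra ast vee.

Local Infix "∗" := ast (at level 40, left associativity).
Local Infix "⋎" := vee (at level 40, left associativity).
Local Infix "⊙" := (ns_mul ast vee) (at level 40, left associativity).

Let astB := nsc_ast_bilinear nscA.

Lemma ns_mul_bilinear : bilinear_map (ns_mul ast vee).
Proof.
apply: bilinear_map_add (nsc_vee_bilinear nscA).
by apply: bilinear_map_add; last exact: bilinear_map_flip.
Qed.

Lemma ns_mulC : commutative (ns_mul ast vee).
Proof.
by move=> x y; rewrite /ns_mul (nsc_vee_comm nscA) [y ∗ x + _]addrC.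
Qed.

Lemma ns_mulCA : left_commutative (ns_mul ast vee).
Proof.
have expand x y z : x ⊙ (y ⊙ z)
    = x ∗ (y ∗ z) + x ∗ (z ∗ y) + y ∗ (z ∗ x) + (x ∗ (y ⋎ z) + x ⋎ (y ⊙ z)).
  rewrite {1}/ns_mul (nsc_ast nscA y z x) {1}/ns_mul !(bilinear_mapDr astB).
  by zmod.
move=> x y z; rewrite !expand (nsc_vee nscA x y z); congr (_ + _).
by rewrite addrAC; congr (_ + _ + _); rewrite !(nsc_ast nscA) (ns_mulC x y).
Qed.

Lemma ns_mul_comm_assoc : comm_assoc_algebra (ns_mul ast vee).
Proof.
split; [exact: ns_mul_bilinear | exact: ns_mulC |].
by move=> x y z; rewrite (ns_mulC y) ns_mulCA ns_mulC.
Qed.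

Lemma ast_representation : comm_assoc_representation (ns_mul ast vee) ast.
Proof. by split=> [|x y z] //=; rewrite (nsc_ast nscA). Qed.

End NSCommutative.

(** * The Lie bracket of an NS-Lie algebra *)

Section NSLie.
Variables (k : fieldType) (A : lmodType k) (dia bul : A -> A -> A).
Hypothesis nslA : NS_Lie_algebra dia bul.

Local Infix "⋄" := dia (at level 40, left associativity).
Local Infix "∙" := bul (at level 40, left associativity).
Local Notation "⟦ x , y ⟧" := (ns_bracket dia bul x y)
  (x at level 99, y at level 99).

Let diaB := nsl_dia_bilinear nslA.

Lemma ns_bracket_bilinear : bilinear_map (ns_bracket dia bul).
Proof.
apply: bilinear_map_add (nsl_bul_bilinear nslA).
apply: bilinear_map_add => //; apply: bilinear_map_opp.
exact: bilinear_map_flip.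
Qed.

Lemma dia_bracket x y z : ⟦x, y⟧ ⋄ z = x ⋄ (y ⋄ z) - y ⋄ (x ⋄ z).
Proof.
rewrite /ns_bracket !(bilinear_mapDl diaB) (bilinear_mapNl diaB).
by rewrite -(nsl_dia nslA); zmod.
Qed.

Lemma ns_bracket_jacobi x y z :
  ⟦x, ⟦y, z⟧⟧ + ⟦y, ⟦z, x⟧⟧ + ⟦z, ⟦x, y⟧⟧ = 0.
Proof.
have expand u v w : ⟦u, ⟦v, w⟧⟧ = u ⋄ (v ⋄ w) - u ⋄ (w ⋄ v)
    - v ⋄ (w ⋄ u) + w ⋄ (v ⋄ u) + (u ∙ ⟦v, w⟧ + u ⋄ (v ∙ w)).
  rewrite {1}/ns_bracket dia_bracket {1}/ns_bracket.
  by rewrite !(bilinear_mapDr diaB) (bilinear_mapNr diaB); zmod.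
by rewrite !expand -[RHS](nsl_bul nslA x y z); zmod.
Qed.

(** Skew-symmetry of ∙ gives x ∙ x = - (x ∙ x); characteristic 0 turns this
    into the alternating law. *)
Lemma ns_bracket_alternating : [pchar k] =i pred0 -> forall x, ⟦x, x⟧ = 0.
Proof.
move=> char0 x; rewrite /ns_bracket subrr add0r.
have /eqP : (2%:R : k) *: (x ∙ x) = 0.
  by rewrite scaler_nat mulr2n {2}(nsl_bul_skew nslA) subrr.
rewrite scaler_eq0 => /orP[two0 | /eqP //].
by have := char0 2; rewrite !inE /= two0.
Qed.

Lemma ns_bracket_lie :
  [pchar k] =i pred0 -> lie_algebra (ns_bracket dia bul).
Proof.
move=> char0; split; [exact: ns_bracket_bilinear | | exact: ns_bracket_jacobi].
exact: ns_bracket_alternating.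
Qed.

Lemma dia_representation : lie_representation (ns_bracket dia bul) dia.
Proof. by split=> // x y z; exact: dia_bracket. Qed.

End NSLie.

(** * Compatibility of the two products *)

Section NSFManifold.
Variables (k : fieldType) (A : lmodType k) (ast vee dia bul : A -> A -> A).
Hypothesis nsA : NS_F_manifold_algebra ast vee dia bul.

Local Infix "∗" := ast (at level 40, left associativity).
Local Infix "⋎" := vee (at level 40, left associativity).
Local Infix "⋄" := dia (at level 40, left associativity).
Local Infix "⊙" := (ns_mul ast vee) (at level 40, left associativity).
Local Notation F1 := (ns_F1 ast dia bul).
Local Notation F2 := (ns_F2 ast vee dia).
Local Notation F3 := (ns_F3 ast vee dia bul).
Local Notation P := (leibnizator (ns_mul ast vee) (ns_bracket dia bul)).

Let astB := nsc_ast_bilinear (nsf_commutative nsA).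
Let diaB := nsl_dia_bilinear (nsf_lie nsA).

(** F1 and F2 collect the terms of P in which a given entry is the rightmost
    argument of the actions ∗ and ⋄: z for F1(x, y, z), y for F1(x, z, y) and x
    for F2(y, z, x), with ⊙ and the bracket acting as wholes. What is left,
    terms that each contain ⋎ or ∙, makes up F3. *)
Lemma leibnizatorE x y z :
  P x y z = F1 x y z + F1 x z y + F2 y z x + F3 x y z.
Proof.
rewrite /leibnizator /ns_F1 /ns_F2 /ns_F3.
(* Unfolded are the products seen from outside, and those standing on the right
   of ∗ or ⋄; the brackets to the left of ∗ match as atoms. *)
have dia_mul : x ⋄ (y ⊙ z) = x ⋄ (y ∗ z) + x ⋄ (z ∗ y) + x ⋄ (y ⋎ z).
  by rewrite /ns_mul !(bilinear_mapDr diaB).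
have ast_bracket u v : u ∗ ns_bracket dia bul x v
    = u ∗ (x ⋄ v) - u ∗ (v ⋄ x) + u ∗ bul x v.
  by rewrite /ns_bracket !(bilinear_mapDr astB) (bilinear_mapNr astB).
have bracketE u : ns_bracket dia bul x u = x ⋄ u - u ⋄ x + bul x u by [].
have mulE u v : u ⊙ v = u ∗ v + v ∗ u + u ⋎ v by [].
rewrite (bracketE (y ⊙ z)) (mulE (ns_bracket dia bul x y)).
by rewrite (mulE y (ns_bracket dia bul x z)) !ast_bracket dia_mul; zmod.
Qed.

Lemma ast_leibnizator x y z w : P x y z ∗ w = F2 y z (x ∗ w) - x ∗ F2 y z w.
Proof. by rewrite leibnizatorE (nsf_F2 nsA). Qed.

Lemma ns_F2_mul x y z w : F2 z w (x ⊙ y)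
  = P x z w ∗ y + x ∗ F2 z w y + (P y z w ∗ x + y ∗ F2 z w x)
    + F2 z w (y ⋎ x).
Proof.
have F2D u v : F2 z w (u + v) = F2 z w u + F2 z w v.
  by rewrite /ns_F2 !(bilinear_mapDr diaB) !(bilinear_mapDr astB); zmod.
rewrite {1}/ns_mul (nsc_vee_comm (nsf_commutative nsA) x) !F2D.
by rewrite !ast_leibnizator !subrK.
Qed.

Lemma ns_hertling_manin x y z w : P (x ⊙ y) z w = x ⊙ P y z w + y ⊙ P x z w.
Proof.
rewrite leibnizatorE !(nsf_F1 nsA) ns_F2_mul.
have F3E : F3 (x ⊙ y) z w = x ∗ F3 y z w + y ∗ F3 x z w
    + x ⋎ P y z w + y ⋎ P x z w - F2 z w (y ⋎ x).
  by rewrite !leibnizatorE -(nsf_F3 nsA) addrK.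
have astP u v : u ∗ P v z w
    = u ∗ F1 v z w + u ∗ F1 v w z + u ∗ F2 z w v + u ∗ F3 v z w.
  by rewrite leibnizatorE !(bilinear_mapDr astB).
by rewrite F3E /ns_mul !astP; zmod.
Qed.

Lemma ns_F_manifold_algebra : [pchar k] =i pred0 ->
  F_manifold_algebra (ns_mul ast vee) (ns_bracket dia bul).
Proof.
move=> char0; split.
- exact: ns_mul_comm_assoc (nsf_commutative nsA).
- exact: ns_bracket_lie (nsf_lie nsA) char0.
- exact: ns_hertling_manin.
Qed.

Lemma ns_F_manifold_representation : [pchar k] =i pred0 ->
  F_manifold_representation (ns_mul ast vee) (ns_bracket dia bul) ast dia.
Proof.
move=> char0; split.
- exact: ns_F_manifold_algebra.
- exact: ast_representation (nsf_commutative nsA).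
- exact: dia_representation (nsf_lie nsA).
- exact: nsf_F1 nsA.
- exact: ast_leibnizator.
Qed.

End NSFManifold.

Theorem theorem5p4 (k : fieldType) (char0 : [pchar k] =i pred0)
    (A : lmodType k) (ast vee dia bul : A -> A -> A)
    (nsA : NS_F_manifold_algebra ast vee dia bul) :
  F_manifold_algebra (ns_mul ast vee) (ns_bracket dia bul) /\
  F_manifold_representation (ns_mul ast vee) (ns_bracket dia bul)
    (fun x y : A => ast x y) (fun x y : A => dia x y).
Proof.
split; first exact: ns_F_manifold_algebra nsA char0.
exact: ns_F_manifold_representation nsA char0.
Qed.
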